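(* Let $z\in(0,1)$ and let $\rho\in\mathcal M(X)$. Let $B$ be the Bayes kernel from $\mathcal M^{\cdot\cdot}(X)$ to $\mathcal M(X)$ of the Pólya sum process $\mathsf S_{z,\rho}$ with prior $\mathsf D_{z,\rho}$, i.e. the stochastic kernel satisfying $$\iint f(\mu,\kappa)\,\mathbf P_{\kappa}(\mathrm d\mu)\,\mathsf D_{z,\rho}(\mathrm d\kappa)=\iint f(\mu,\kappa)\,B(\mu,\mathrm d\kappa)\,\mathsf S_{z,\rho}(\mathrm d\mu)$$ for all non-negative measurable $f$ on $\mathcal M^{\cdot\cdot}(X)\times\mathcal M(X)$, and let $b(\mu)=\int\kappa\,B(\mu,\mathrm d\kappa)$ be the Bayes estimator for the intensity measure of the Poisson process given the observation $\mu\in\mathcal M^{\cdot\cdot}(X)$. Then $$b(\mu)=z(\rho+\mu)\qquad\text{for }\mathsf S_{z,\rho}\text{-almost every }\mu .$$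
   Context: $X$ is a Polish space, $\mathcal B_0$ the ring of bounded Borel sets of $X$ (for a fixed complete metric). $\mathcal M(X)$ is the space of locally finite measures on $X$ (finite on every $B\in\mathcal B_0$) and $\mathcal M^{\cdot\cdot}(X)$ the subset of locally finite point measures (non-negative integer-valued, multiple points allowed), both with the $\sigma$-algebra generated by the maps $\mu\mapsto\mu(B)$, $B\in\mathcal B_0$. A random measure is a probability measure on $\mathcal M(X)$; it is a point process if concentrated on $\mathcal M^{\cdot\cdot}(X)$. $\mathbf P_\kappa$ denotes the Poisson process with intensity measure $\kappa\in\mathcal M(X)$. The measure $\int\kappa\,B(\mu,\mathrm d\kappa)$ is the intensity measure of $B(\mu,\cdot)$, i.e. the measure $A\mapsto\int\kappa(A)\,B(\mu,\mathrm d\kappa)$. For $z\in(0,1)$ and $\rho\in\mathcal M(X)$, the Poisson-Gamma random measure $\mathsf D_{z,\rho}$ is the infinitely divisible random measure on $X$ whose Lévy measure is the image of $\rho\otimes\tau_z$ under $(x,r)\mapsto r\delta_x$, where $\tau_z(\mathrm dr)=\frac1r e^{-\frac{1-z}{z}r}\,\mathrm dr$ on $(0,\infty)$; equivalently, its Laplace transform is $\int e^{-\kappa(h)}\,\mathsf D_{z,\rho}(\mathrm d\kappa)=\exp\left[-\iint(1-e^{-rh(x)})\,\tau_z(\mathrm dr)\,\rho(\mathrm dx)\right]$ for bounded non-negative measurable $h$. The Pólya sum process $\mathsf S_{z,\rho}$ is the unique point process $\mathsf P$ on $X$ satisfying $\iint h(x,\mu)\,\mu(\mathrm dx)\,\mathsf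 P(\mathrm d\mu)=z\iint h(x,\mu+\delta_x)\,(\rho+\mu)(\mathrm dx)\,\mathsf P(\mathrm d\mu)$ for all bounded non-negative measurable $h$ on $X\times\mathcal M^{\cdot\cdot}(X)$. It is known that $\mathsf S_{z,\rho}=\int\mathbf P_\kappa\,\mathsf D_{z,\rho}(\mathrm d\kappa)$. The Bayes kernel is determined up to $\mathsf S_{z,\rho}$-null sets of $\mu$. *)

(* Defs.v *)
From HB Require Import structures.
From mathcomp Require Import all_boot all_order all_algebra.
From mathcomp Require Import all_classical all_reals all_analysis.
From mathcomp Require Import measurable_realfun.

Set Implicit Arguments.
Unset Strict Implicit.
Unset Printing Implicit Defensive.

Import Order.TTheory GRing.Theory Num.Theory.
Import numFieldNormedType.Exports.

Local Open Scope classical_set_scope.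
Local Open Scope ring_scope.
Local Open Scope ereal_scope.

HB.mixin Record isSeparable T & Topological T := {
  separable : exists2 A : set T, countable A & dense A
}.

(* A Polish space together with a fixed complete metric; [Complete] is the
   completeness of the uniformity induced by [mdist]. *)
#[short(type="polishType")]
HB.structure Definition Polish (R : numDomainType) :=
  { T of Metric R T & Complete T & isSeparable T }.

Definition borel (X : ptopologicalType) : measurableType (@open X).-sigma :=
  g_sigma_algebraType (@open X).

Definition bounded_borel {R : realType} {X : polishType R}
    (B : set (borel X)) : Prop :=
  measurable B /\
  exists r : R, forall x y : X, B x -> B y -> (mdist x y <= r)%R.

(* As for [giry], the values of a measure off the measurable sets are
   unconstrained; the sigma-algebras below do not see them. *)
Record lfmeasure (R : realType) (X : polishType R) := LFMeasure {
  lfm_measure :> {measure set (borel X) -> \bar R} ;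
  lfm_fin : forall B, bounded_borel B -> lfm_measure B < +oo
}.

Record pmeasure (R : realType) (X : polishType R) := PMeasure {
  pm_lfm :> lfmeasure X ;
  pm_nat : forall B, bounded_borel B -> exists n : nat, pm_lfm B = n%:R%:E
}.

Section zero_measure.
Context {R : realType} {X : polishType R}.

Let lfm0_fin B : bounded_borel B -> @mzero _ (borel X) R B < +oo.
Proof. by rewrite /mzero ltry. Qed.

Definition lfm0 : lfmeasure X := LFMeasure lfm0_fin.

Let pm0_nat B : bounded_borel B -> exists n : nat, lfm0 B = n%:R%:E.
Proof. by exists 0%N. Qed.

Definition pm0 : pmeasure X := PMeasure pm0_nat.

End zero_measure.

Definition lfm_display : measure_display.
Proof. by constructor. Qed.

Definition pm_display : measure_display.
Proof. by constructor. Qed.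

Section measurable_lfmeasure.
Context (R : realType) (X : polishType R).

HB.instance Definition _ := gen_eqMixin (lfmeasure X).
HB.instance Definition _ := gen_choiceMixin (lfmeasure X).
HB.instance Definition _ := isPointed.Build (lfmeasure X) lfm0.

Definition lfm_measurable : set_system (lfmeasure X) :=
  <<s \bigcup_(B in bounded_borel)
        preimage_set_system setT (fun mu : lfmeasure X => mu B)
          (measurable : set (set (\bar R))) >>.

HB.instance Definition _ := @isMeasurable.Build lfm_display (lfmeasure X)
  lfm_measurable (@sigma_algebra0 _ setT _) (@sigma_algebraC _ _)
  (@sigma_algebra_bigcup _ setT _).

HB.instance Definition _ := gen_eqMixin (pmeasure X).
HB.instance Definition _ := gen_choiceMixin (pmeasure X).
HB.instance Definition _ := isPointed.Build (pmeasure X) pm0.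

Definition pm_measurable : set_system (pmeasure X) :=
  <<s \bigcup_(B in bounded_borel)
        preimage_set_system setT (fun mu : pmeasure X => mu B)
          (measurable : set (set (\bar R))) >>.

HB.instance Definition _ := @isMeasurable.Build pm_display (pmeasure X)
  pm_measurable (@sigma_algebra0 _ setT _) (@sigma_algebraC _ _)
  (@sigma_algebra_bigcup _ setT _).

End measurable_lfmeasure.

(* A law on [lfmeasure X] concentrated on the point measures is represented by
   the corresponding law on [pmeasure X]. *)
Notation random_measure R X := (probability (lfmeasure (R := R) X) R).
Notation point_process R X := (probability (pmeasure (R := R) X) R).

Section add_point.
Context {R : realType} {X : polishType R}.
Variables (mu : pmeasure X) (x : borel X).

Let m : {measure set (borel X) -> \bar R} := measure_add mu (dirac x).

Let mE B : m B = mu B + \d_x B.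
Proof. by rewrite -measure_addE. Qed.

Let add_point_fin B : bounded_borel B -> m B < +oo.
Proof.
by move=> bB; rewrite mE lte_add_pinfty ?(lfm_fin mu)// diracE ltry.
Qed.

Let add_point_nat B : bounded_borel B ->
  exists n : nat, LFMeasure add_point_fin B = n%:R%:E.
Proof.
move=> /(pm_nat mu)[n mun]; exists (n + (x \in B))%N.
by rewrite /= mE mun diracE natrD EFinD; case: (x \in B).
Qed.

Definition add_point : pmeasure X := PMeasure add_point_nat.

End add_point.

Section processes.
Context {R : realType} {X : polishType R}.

(* The counts over pairwise disjoint bounded Borel sets are independent and
   Poisson distributed; the weight is spelled out since [poisson_pmf 0 k] is
   1 for all k. *)
Definition poisson_process (kappa : lfmeasure X) (P : point_process R X) :=
  forall (n : nat) (B : 'I_n -> set (borel X)) (k : 'I_n -> nat),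
    (forall i, bounded_borel (B i)) -> trivIset setT B ->
    P [set mu | forall i, mu (B i) = (k i)%:R%:E] =
    (\prod_(i < n) (fine (kappa (B i)) ^+ k i / (k i)`!%:R
                    * expR (- fine (kappa (B i)))))%:E.

(* Laplace transform of the infinitely divisible random measure whose Levy
   measure is the image under (x, r) |-> r \d_x of the product of rho and
   tau_z(dr) = r^-1 * exp(- ((1 - z) / z) r) dr on ]0, +oo[; h need not have
   bounded support, so both sides may be expeR -oo = 0. *)
Definition poisson_gamma (z : R) (rho : lfmeasure X)
    (D : random_measure R X) :=
  forall h : borel X -> R,
    measurable_fun setT h -> (forall x, 0 <= h x)%R ->
    (exists M : R, forall x, h x <= M)%R ->
    \int[D]_kappa expeR (- \int[kappa]_x (h x)%:E) =
    expeR (- \int[rho]_x \int[lebesgue_measure]_(r in `]0%R, +oo[)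
      ((1 - expR (- (r * h x))) * (r^-1 * expR (- ((1 - z) / z) * r)))%:E).

(* This integration by parts formula has a unique solution S. *)
Definition polya_sum (z : R) (rho : lfmeasure X) (S : point_process R X) :=
  forall h : borel X * pmeasure X -> R,
    measurable_fun setT h -> (forall p, 0 <= h p)%R ->
    (exists M : R, forall p, h p <= M)%R ->
    \int[S]_mu \int[mu]_x (h (x, mu))%:E =
    z%:E * \int[S]_mu \int[measure_add rho mu]_x (h (x, add_point mu x))%:E.

Definition bayes_kernel (P : lfmeasure X -> point_process R X)
    (D : random_measure R X) (S : point_process R X)
    (B : R.-pker (pmeasure X) ~> (lfmeasure X)) :=
  forall f : pmeasure X * lfmeasure X -> \bar R,
    measurable_fun setT f -> (forall p, 0 <= f p) ->
    \int[D]_kappa \int[P kappa]_mu f (mu, kappa) =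
    \int[S]_mu \int[B mu]_kappa f (mu, kappa).

Definition intensity (Q : {measure set (lfmeasure X) -> \bar R})
    (A : set (borel X)) : \bar R :=
  \int[Q]_kappa kappa A.

End processes.

(* Main.v *)
Require Import Defs.
From HB Require Import structures.
From mathcomp Require Import all_boot all_order all_algebra.
From mathcomp Require Import all_classical all_reals all_analysis.
From mathcomp Require Import measurable_realfun ring.

Set Implicit Arguments.
Unset Strict Implicit.
Unset Printing Implicit Defensive.

Import Order.TTheory GRing.Theory Num.Theory.
Import numFieldNormedType.Exports.

Local Open Scope classical_set_scope.
Local Open Scope ring_scope.
Local Open Scope ereal_scope.

(** For a mixed Poisson process, the posterior mean [b mu] of the mixing measure
    is the Papangelou kernel: averaging the integration by parts formulas of the
    Poisson processes over the prior gives such a formula for [S] with kernel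
    [b mu].  The Polya sum process is defined by an integration by parts formula
    with kernel [z (rho + mu)], and this kernel is almost surely determined by the
    law of the process, whence the identity.

    Only the trace of this argument on finitely many counts is used.  Let [E] be
    the event that the counts of [mu] over disjoint bounded Borel sets [C i] are
    [k i], and let [E'] be the same event with [k j] replaced by [k j + 1].  The
    Poisson weights satisfy
      [kappa (C j) * P_kappa E = (k j + 1) * P_kappa E'],
    so, after integration over the prior, the Bayes formula gives
      [\int_E b mu (C j) dS = (k j + 1) * S E']
    ([integral_posterior_cylinder]).  The Polya formula, tested on the function
    [(x, mu) |-> 1_(C j) x * 1_E' mu], gives the same value for
    [\int_E z (rho + mu) (C j) dS] ([integral_polya_cylinder]): for [x] in [C j],
    the measure [mu + \d_x] is in [E'] exactly when [mu] is in [E].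

    It remains to see that these identities determine the kernel
    ([ae_eq_of_disjoint_cylinders]).  Splitting the sets involved into atoms
    extends them from disjoint to arbitrary bounded sets; then the events [E]
    form a pi-system generating the sigma-algebra of point configurations, so for
    each bounded [A] the two integrands agree almost everywhere.  A countable
    pi-system of bounded sets generates the Borel sets of a Polish space, and this
    yields one null set valid for all [A]. *)

(** * Bounded Borel sets of a Polish space *)

Section polish.
Context {R : realType} {X : polishType R}.
Implicit Types A B : set (borel X).

Lemma open_measurable_borel (U : set X) :
  open U -> measurable (U : set (borel X)).
Proof. by move=> oU; exact: sub_sigma_algebra. Qed.

Lemma bounded_borelS A B :
  measurable A -> A `<=` B -> bounded_borel B -> bounded_borel A.
Proof.
by move=> mA AB [_ [r Br]]; split=> //; exists r => x y /AB Bx /AB; exact: Br.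
Qed.

Lemma bounded_borel0 : bounded_borel (set0 : set (borel X)).
Proof. by split=> //; exists 0%R. Qed.

Lemma open_ball_metric (x : X) (r : R) : open (ball x r).
Proof.
rewrite openE => y; rewrite ballEmdist/= => xyr.
apply/nbhs_ballP; exists (r - mdist x y)%R => /=; first by rewrite subr_gt0.
move=> t; rewrite !ballEmdist/= ltrBrDl.
by apply: le_lt_trans; exact: metric_triangle.
Qed.

Lemma bounded_borel_ball (x : X) (r : R) :
  bounded_borel (ball x r : set (borel X)).
Proof.
split; first by apply: open_measurable_borel; exact: open_ball_metric.
exists (r + r)%R => y t; rewrite ballEmdist/= => xy xt.
apply: (le_trans (metric_triangle y x t)); rewrite metric_sym.
by rewrite lerD// ltW.
Qed.

(** The balls of radius [1/(m+1)] around the points of a countable dense set,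
    the pairs (centre, [m]) being coded by natural numbers. *)
Lemma bounded_base : exists U : nat -> set X,
  [/\ forall n, open (U n), forall n, bounded_borel (U n : set (borel X)) &
      forall O : set X, open O -> O = \bigcup_(n in [set n | U n `<=` O]) U n].
Proof.
have [D cD dD] := @separable _ X.
have [d dE] : exists d : nat -> X, D `<=` range d.
  have /pfcard_geP[->|[d]] := cD; first by exists (fun=> point).
  exists d => x Dx.
  have [n _ <-] := @surj _ _ _ _ d x Dx.
  by exists n.
pose p i := odflt (0, 0)%N (unpickle i : option (nat * nat)).
pose U i : set X := ball (d (p i).1) ((p i).2.+1%:R^-1 : R)%R.
exists U; split=> [n|n|O oO].
- exact: open_ball_metric.
- exact: bounded_borel_ball.
- apply/seteqP; split=> [x Ox|x [n Un]]; last exact: Un.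
  have [e/= e0 xe] : nbhs_ball x O by rewrite nbhs_ballE; exact: open_nbhs_nbhs.
  have [k ke] : exists k : nat, (k.+1%:R^-1 < e / 2)%R.
    have e20 : (0 < e / 2)%R by rewrite divr_gt0.
    have [N _ /(_ N)/=] := near_infty_natSinv_lt (PosNum e20).
    by rewrite leqnn => /(_ isT); exists N.
  have [y [xy /dE[n _ dny]]] : ball x (k.+1%:R^-1 : R)%R `&` D !=set0.
    apply: dD; last exact: open_ball_metric.
    by exists x; apply: ballxx; rewrite invr_gt0.
  exists (pickle (n, k)); rewrite /U /p/= pickleK/= dny; last exact: ball_sym.
  move=> t yt; apply: xe; apply: (@le_ball _ _ _ (k.+1%:R^-1 + k.+1%:R^-1)%R).
    by rewrite [leRHS]splitr lerD// ltW.
  exact: ball_triangle yt.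
Qed.

(** The finite intersections of the sets of a countable base.  The countability
    is what allows to exchange [for all Borel sets] and [almost surely]. *)
Lemma bounded_pi_system : exists G : nat -> set (borel X),
  [/\ forall n, bounded_borel (G n), setI_closed (range G),
      \bigcup_n G n = setT & measurable = <<s range G >> ].
Proof.
have [U [oU bU UO]] := bounded_base.
(* Nonempty lists of indices, since the whole space may be unbounded. *)
pose I (p : nat * seq nat) : set (borel X) :=
  foldr (fun i C => U i `&` C) (U p.1) p.2.
have bI p : bounded_borel (I p).
  case: p => i s; rewrite /I/=; elim: s => [|j s IH] //=.
  apply: bounded_borelS (bU j) => //.
  by apply: measurableI; case: IH (bU j) => ? _ [].
pose G n := I (odflt (0%N, [::]) (unpickle n : option (nat * seq nat))).
have GI p : G (pickle p) = I p by rewrite /G pickleK.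
have GU i : G (pickle (i, [::] : seq nat)) = U i by rewrite GI.
exists G; split.
- by move=> n; exact: bI.
- move=> _ _ [m _ <-] [n _ <-]; rewrite /G.
  case: (odflt _ _) => i s; case: (odflt _ _) => j t.
  exists (pickle (j, s ++ i :: t)) => //; rewrite pickleK /I/=.
  by elim: s => [|k s IH] /=; [rewrite setIC|rewrite IH setIA].
- rewrite -subTset => x _.
  have : (setT : set X) x by [].
  rewrite (UO setT openT) => -[i _ Uix].
  by exists (pickle (i, [::] : seq nat)) => //; rewrite GU.
- apply/seteqP; split.
  + apply: smallest_sub; first exact: smallest_sigma_algebra.
    move=> O /UO ->.
    apply: (@bigcup_measurable _ (g_sigma_algebraType (range G))).
    move=> i _; apply: sub_sigma_algebra.
    by exists (pickle (i, [::] : seq nat)).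
  + apply: smallest_sub; first exact: sigma_algebra_measurable.
    by move=> _ [n _ <-]; have [] := bI (odflt (0%N, [::]) (unpickle n)).
Qed.

End polish.

(** * Evaluation maps and intensity measures *)

Section evaluation.
Context {R : realType} {X : polishType R}.
Implicit Types A B : set (borel X).

Lemma measurable_eval_bounded B : bounded_borel B ->
  measurable_fun setT (fun kappa : lfmeasure X => kappa B).
Proof.
move=> bB _ Y mY; apply: sub_sigma_algebra.
by exists B => //; exists Y.
Qed.

Lemma measurable_count_bounded B : bounded_borel B ->
  measurable_fun setT (fun mu : pmeasure X => mu B).
Proof.
move=> bB _ Y mY; apply: sub_sigma_algebra.
by exists B => //; exists Y.
Qed.

(** The sigma-algebra of [lfmeasure X] is generated by the evaluations on bounded
    sets; other Borel sets are countable disjoint unions of bounded ones. *)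
Lemma measurable_eval A : measurable A ->
  measurable_fun setT (fun kappa : lfmeasure X => kappa A).
Proof.
move=> mA; have [G [bG _ Gcover _]] := @bounded_pi_system R X.
pose W n := A `&` seqDU G n.
have mG n : measurable (G n) by case: (bG n).
have mW n : measurable (W n) by apply: measurableI => //; exact: seqDU_measurable.
have AW : A = \bigcup_n W n.
  by rewrite -setI_bigcupr -seqDU_bigcup_eq Gcover setIT.
rewrite (_ : (fun _ => _) =
    fun kappa : lfmeasure X => \sum_(n <oo) kappa (W n)).
  apply: ge0_emeasurable_sum => // n _; apply: measurable_eval_bounded.
  by apply: bounded_borelS (bG n) => // x [_ []].
apply/funext => kappa; rewrite {1}AW measure_semi_bigcup -?AW//.
by apply: trivIset_setIl; exact: trivIset_seqDU.
Qed.

Section intensity_measure.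
Variable Q : {measure set (lfmeasure X) -> \bar R}.

Let intensity0 : intensity Q set0 = 0.
Proof.
by rewrite /intensity; under eq_integral do rewrite measure0; rewrite integral0.
Qed.

Let intensity_ge0 A : 0 <= intensity Q A.
Proof. by apply: integral_ge0. Qed.

Let intensity_sigma_additive : semi_sigma_additive (intensity Q).
Proof.
move=> F mF tF mUF; rewrite [X in _ --> X](_ : _ =
  \int[Q]_kappa (\sum_(n <oo) kappa (F n))); last first.
  apply: eq_integral => kappa _.
  by apply/esym/cvg_lim => //; exact/measure_semi_sigma_additive.
apply/cvg_closeP; split.
  by apply: is_cvg_nneseries => n _ _; exact: integral_ge0.
by rewrite closeE// integral_nneseries// => n; exact: measurable_eval.
Qed.

HB.instance Definition _ := isMeasure.Build _ _ R (intensity Q)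
  intensity0 intensity_ge0 intensity_sigma_additive.

End intensity_measure.
End evaluation.

(** * Almost sure equality from a pi-system *)

Section density.
Context d (T : measurableType d) (R : realType).
Variables (mu : {measure set T -> \bar R}) (f : T -> \bar R).

(** The proofs are arguments so that the measure structure can be inferred from
    the term. *)
Definition with_density of measurable_fun setT f & (forall x, 0 <= f x) :=
  fun E : set T => \int[mu]_(x in E) f x.

Variables (mf : measurable_fun setT f) (f0 : forall x, 0 <= f x).

Let with_density0 : with_density mf f0 set0 = 0.
Proof. by rewrite /with_density integral_set0. Qed.

Let with_density_ge0 E : 0 <= with_density mf f0 E.
Proof. by apply: integral_ge0 => x _; exact: f0. Qed.

Let with_density_sigma_additive : semi_sigma_additive (with_density mf f0).
Proof.
move=> F mF tF _; rewrite /with_density ge0_integral_bigcup//.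
- by apply/is_cvg_nneseries => n _ _; exact: with_density_ge0.
- exact: measurable_funTS.
Qed.

HB.instance Definition _ := isMeasure.Build _ _ R (with_density mf f0)
  with_density0 with_density_ge0 with_density_sigma_additive.

End density.

(** The measures with densities [a] and [b] agree on a generating pi-system on
    which they are sigma-finite, hence everywhere; so their densities agree almost
    everywhere on each [g k], where they are integrable. *)
Lemma ae_eq_pi_system d (T : measurableType d) (R : realType)
    (mu : {measure set T -> \bar R}) (G : set (set T)) (g : (set T)^nat)
    (a b : T -> \bar R) :
  measurable = <<s G >> -> setI_closed G -> (forall k, G (g k)) ->
  \bigcup_k g k = setT ->
  measurable_fun setT a -> measurable_fun setT b ->
  (forall x, 0 <= a x) -> (forall x, 0 <= b x) ->
  (forall E, G E -> \int[mu]_(x in E) a x = \int[mu]_(x in E) b x) ->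
  (forall k, \int[mu]_(x in g k) a x < +oo) ->
  {ae mu, forall x, a x = b x}.
Proof.
move=> GE GI Gg gT ma mb a0 b0 abG afin.
have ab E : measurable E -> \int[mu]_(x in E) a x = \int[mu]_(x in E) b x.
  move=> mE.
  exact: (measure_unique G g GE GI Gg gT (with_density mu ma a0)
    (with_density mu mb b0) abG afin).
have mg k : measurable (g k) by rewrite GE; exact: sub_sigma_algebra.
have abg k : {ae mu, forall x, g k x -> a x = b x}.
  apply: integral_ae_eq => //; [|exact: measurable_funTS|by move=> E _ /ab].
  apply/integrableP; split; first exact: measurable_funTS.
  by under eq_integral do rewrite gee0_abs//.
apply: filterS (ae_foralln abg) => x /= abx.
by have : setT x by []; rewrite -gT => -[k _ /abx].
Qed.

(** * Events prescribing finitely many counts *)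

Section cylinders.
Context {R : realType} {X : polishType R}.

Definition cylinder n (C : 'I_n -> set (borel X)) (k : 'I_n -> nat)
    : set (pmeasure X) :=
  [set mu | forall i, mu (C i) = (k i)%:R%:E].

Definition incr_at n (k : 'I_n -> nat) (j i : 'I_n) : nat := (k i + (i == j))%N.

Lemma cylinder1 A k : cylinder (fun _ : 'I_1 => A) (fun=> k) =
  [set mu : pmeasure X | mu A = k%:R%:E].
Proof. by apply/seteqP; split=> [mu /(_ ord0)|mu muA i]. Qed.

Lemma measurable_cylinder n (C : 'I_n -> set (borel X)) k :
  (forall i, bounded_borel (C i)) -> measurable (cylinder C k).
Proof.
move=> bC; rewrite (_ : cylinder C k =
    \bigcap_(i in setT)
      ((fun mu : pmeasure X => mu (C i)) @^-1` [set (k i)%:R%:E])).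
  apply: fin_bigcap_measurable => // i _; rewrite -[X in measurable X]setTI.
  exact: (measurable_count_bounded (bC i) measurableT (emeasurable_set1 _)).
by apply/seteqP; split=> [mu kmu i _|mu kmu i]; [exact: kmu|exact: kmu i I].
Qed.

(** The Poisson weights [p m] of mean [c] satisfy [c * p m = (m + 1) * p (m + 1)];
    the counts over the other sets are independent of the [j]-th one. *)
Lemma poisson_size_bias (kappa : lfmeasure X) (P : point_process R X)
    n (C : 'I_n -> set (borel X)) (k : 'I_n -> nat) (j : 'I_n) :
  poisson_process kappa P ->
  (forall i, bounded_borel (C i)) -> trivIset setT C ->
  P (cylinder C k) * kappa (C j) =
  (k j).+1%:R%:E * P (cylinder C (incr_at k j)).
Proof.
move=> PP bC tC; rewrite /cylinder !PP//.
rewrite -[kappa (C j)]fineK; last first.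
  by rewrite ge0_fin_numE// lfm_fin.
rewrite -!EFinM; congr EFin; rewrite [in LHS](bigD1 j)//= [in RHS](bigD1 j)//=.
rewrite /incr_at eqxx addn1 factS natrM exprSr.
rewrite [X in _ = (_ * (_ * X))%R](eq_bigr (fun i =>
  (fine (kappa (C i)) ^+ k i / (k i)`!%:R *
   expR (- fine (kappa (C i))))%R)); last first.
  by move=> i /negPf ->; rewrite addn0.
have k0 : ((k j).+1%:R : R) != 0%R by rewrite pnatr_eq0.
have kf0 : ((k j)`!%:R : R) != 0%R by rewrite pnatr_eq0 -lt0n fact_gt0.
by field; rewrite kf0 nat1r k0.
Qed.

(** By disjointness, a point of [C j] is counted by [C j] only. *)
Lemma add_point_cylinder n (C : 'I_n -> set (borel X)) (k : 'I_n -> nat)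
    (j : 'I_n) (mu : pmeasure X) (x : borel X) :
  (forall i, bounded_borel (C i)) -> trivIset setT C -> C j x ->
  cylinder C (incr_at k j) (add_point mu x) = cylinder C k mu.
Proof.
move=> bC tC Cjx.
have dE i : \d_x (C i) = (i == j)%:R%:E :> \bar R.
  rewrite diracE; suff -> : (x \in C i) = (i == j) by [].
  apply/idP/idP => [/set_mem Cix|/eqP ->]; last exact/mem_set.
  by apply/eqP; apply: tC => //; exists x.
have addE i : add_point mu x (C i) = mu (C i) + (i == j)%:R%:E.
  by rewrite -dE -measure_addE.
apply/propext; split=> muk i; have := muk i;
  have [m mE] := pm_nat mu (bC i).
  rewrite addE mE /incr_at natrD EFinD => /eqP.
  by rewrite -EFinD -EFinD eqe -!natrD eqr_nat eqn_add2r => /eqP ->.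
by rewrite addE => ->; rewrite /incr_at natrD EFinD.
Qed.

End cylinders.

(** * Integrals over cylinder events *)

Section posterior_mean.
Context {R : realType} {X : polishType R} (z : R) (rho : lfmeasure X).
Context (P : lfmeasure X -> point_process R X) (D : random_measure R X).
Context (S : point_process R X) (B : R.-pker (pmeasure X) ~> (lfmeasure X)).
Hypotheses (PP : forall kappa : lfmeasure X, poisson_process kappa (P kappa)).
Hypotheses (SP : polya_sum z rho S) (BP : bayes_kernel P D S B).
Hypothesis z0 : (0 <= z)%R.

Lemma measurable_posterior_intensity (A : set (borel X)) : measurable A ->
  measurable_fun setT (fun mu => intensity (B mu) A).
Proof.
move=> mA.
apply: (@measurable_fun_integral_finite_kernel _ _ _ _ R
   (fun p : pmeasure X * lfmeasure X => p.2 A) B) => //.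
exact: (measurableT_comp (measurable_eval mA)).
Qed.

Lemma measurable_polya_kernel (A : set (borel X)) : bounded_borel A ->
  measurable_fun setT (fun mu : pmeasure X => z%:E * (rho A + mu A)).
Proof.
move=> bA; apply: measurable_funeM; apply: emeasurable_funD => //.
exact: measurable_count_bounded.
Qed.

Section disjoint_cylinder.
Variables (n : nat) (C : 'I_n -> set (borel X)) (k : 'I_n -> nat) (j : 'I_n).
Hypotheses (bC : forall i, bounded_borel (C i)) (tC : trivIset setT C).

Let E := cylinder C k.
Let E' := cylinder C (incr_at k j).
Let mE : measurable E. Proof. exact: measurable_cylinder. Qed.
Let mE' : measurable E'. Proof. exact: measurable_cylinder. Qed.
Let mCj : measurable (C j). Proof. by case: (bC j). Qed.

(** The Bayes formula is used twice: for [1_E mu * kappa (C j)], which after size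
    biasing becomes a multiple of [1_E' mu], and for the latter in order to go
    back to the mixture [S]. *)
Lemma integral_posterior_cylinder :
  \int[S]_(mu in E) intensity (B mu) (C j) = (k j).+1%:R%:E * S E'.
Proof.
have fE : \int[S]_(mu in E) intensity (B mu) (C j) =
    \int[S]_mu \int[B mu]_kappa ((\1_E mu)%:E * kappa (C j)).
  rewrite integral_mkcond; apply: eq_integral => mu _.
  rewrite ge0_integralZl_EFin//; last exact: measurable_eval.
  by rewrite patchE indicE; case: (mu \in E); rewrite ?mul1e ?mul0e.
rewrite {}fE.
have mf : measurable_fun setT (fun p : pmeasure X * lfmeasure X =>
    (\1_E p.1)%:E * p.2 (C j)).
  apply: emeasurable_funM.
    by apply/measurable_EFinP; exact: (measurableT_comp _ measurable_fst).
  exact: (measurableT_comp (measurable_eval mCj) measurable_snd).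
rewrite -(BP mf); last by move=> p; rewrite mule_ge0.
under eq_integral => kappa _.
  have kfin : kappa (C j) = (fine (kappa (C j)))%:E.
    by rewrite fineK// ge0_fin_numE// lfm_fin.
  rewrite /=; under eq_integral do rewrite muleC.
  rewrite kfin ge0_integralZl_EFin//; last exact/measurable_EFinP.
  rewrite -kfin integral_indic// setIT muleC (poisson_size_bias k j (PP kappa))//.
  rewrite -/E' -[E']setIT -(integral_indic (P kappa) measurableT mE').
  rewrite -ge0_integralZl_EFin//; last exact/measurable_EFinP.
  over.
have mg : measurable_fun setT (fun p : pmeasure X * lfmeasure X =>
    (k j).+1%:R%:E * (\1_E' p.1)%:E : \bar R).
  apply: measurable_funeM; apply/measurable_EFinP.
  exact: (measurableT_comp _ measurable_fst).
rewrite (BP mg); last by move=> p; rewrite mule_ge0.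
under eq_integral do rewrite /= integral_cst// prob_kernel mule1 EFinM.
rewrite ge0_integralZl_EFin//; last exact/measurable_EFinP.
by rewrite integral_indic// setIT.
Qed.

(** The defining formula of the Polya sum process for [1_(C j) x * 1_E' mu]: on
    [E'] the set [C j] carries [k j + 1] points, and adding a point of [C j] leads
    to [E'] exactly from [E]. *)
Lemma integral_polya_cylinder :
  \int[S]_(mu in E) (z%:E * (rho (C j) + mu (C j))) = (k j).+1%:R%:E * S E'.
Proof.
pose h (p : borel X * pmeasure X) : R := (\1_(C j) p.1 * \1_E' p.2)%R.
have mh : measurable_fun setT h.
  apply: measurable_funM.
    exact: (measurableT_comp _ measurable_fst).
  exact: (measurableT_comp _ measurable_snd).
have h0 p : (0 <= h p)%R by rewrite mulr_ge0.
have h1 p : (h p <= 1)%R.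
  by rewrite /h !indicE -natrM mulnb lern1 leq_b1.
have inner (m : {measure set (borel X) -> \bar R}) (c : R) : (0 <= c)%R ->
    \int[m]_x (\1_(C j) x * c)%:E = c%:E * m (C j).
  move=> c0; under eq_integral do rewrite mulrC EFinM.
  rewrite ge0_integralZl_EFin//; last exact/measurable_EFinP.
  by rewrite integral_indic// setIT.
have cnt (mu : pmeasure X) :
    (\1_E' mu)%:E * mu (C j) = (k j).+1%:R%:E * (\1_E' mu)%:E.
  rewrite indicE; have [/set_mem/(_ j) ->|] := boolP (mu \in E').
    by rewrite /incr_at eqxx addn1 muleC.
  by rewrite mul0e mule0.
have := SP mh h0 (ex_intro _ 1%R h1); rewrite /h/=.
under eq_integral do rewrite inner// cnt.
rewrite ge0_integralZl_EFin//; last exact/measurable_EFinP.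
rewrite integral_indic// setIT => ->.
under [in RHS]eq_integral => mu _.
  rewrite (eq_integral (fun x => (\1_(C j) x * \1_E mu)%:E)); last first.
    move=> x _ /=; rewrite !indicE; have [/set_mem Cx|] := boolP (x \in C j).
      suff -> : (add_point mu x \in E') = (mu \in E) by [].
      have Emu := add_point_cylinder k mu bC tC Cx.
      apply/idP/idP => /set_mem Hmu; apply/mem_set; move: Hmu;
        by rewrite /E' /E Emu.
    by rewrite !mul0r.
  rewrite inner// -[_ (C j)]/(measure_add rho mu (C j)) measure_addE.
  over.
rewrite -ge0_integralZl_EFin//; last 2 first.
- by move=> mu _; rewrite mule_ge0// adde_ge0.
- apply: emeasurable_funM; first exact/measurable_EFinP.
  by apply: emeasurable_funD => //; exact: measurable_count_bounded.
rewrite [LHS]integral_mkcond; apply: eq_integral => mu _.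
by rewrite patchE indicE; case: (mu \in E); rewrite ?mul1e ?mul0e ?mule0.
Qed.

End disjoint_cylinder.
End posterior_mean.

(** * Splitting finitely many sets into atoms *)

Section atoms.
Context d (T : measurableType d) (L : finType) (C : L -> set T).

Definition signature (x : T) : {ffun L -> bool} := [ffun i => x \in C i].

(** The fibres of [signature], except that the points outside all the sets form no
    atom: the atoms of bounded sets are then bounded. *)
Definition atom (s : {ffun L -> bool}) : set T :=
  [set x | [exists i, s i] /\ signature x = s].

Lemma trivIset_atom : trivIset setT atom.
Proof. by move=> s t _ _ [x [[_ <-] [_ <-]]]. Qed.

Lemma atom_sub (s : {ffun L -> bool}) i : s i -> atom s `<=` C i.
Proof. by move=> si x [_ xs]; move: si; rewrite -xs ffunE => /set_mem. Qed.

Lemma bigcup_atom i :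
  C i = \bigcup_(s in [set s : {ffun L -> bool} | s i]) atom s.
Proof.
apply/seteqP; split=> [x Cix|x [s /= si]]; last exact: atom_sub.
have sx : signature x i by rewrite ffunE; exact/mem_set.
by exists (signature x) => //; split => //; apply/existsP; exists i.
Qed.

Lemma measurable_atom (s : {ffun L -> bool}) :
  (forall i, measurable (C i)) -> measurable (atom s).
Proof.
move=> mC; have [s0|s0] := boolP [exists i, s i]; last first.
  by rewrite (_ : atom s = set0)// -subset0 => x [sx _]; move: s0; rewrite sx.
rewrite (_ : atom s = \bigcap_(i in setT) (if s i then C i else ~` C i)).
  apply: fin_bigcap_measurable => [|i _]; first exact: finite_finset.
  by case: ifP => _ //; exact: measurableC.
apply/seteqP; split=> [x [_ <-] i _|x xs].
  by rewrite ffunE; case: ifPn => [/set_mem//|]; rewrite notin_setE.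
split => //; apply/ffunP => i; rewrite ffunE; have := xs i I.
by case: ifP => _ h; [exact/mem_set|apply: memNset].
Qed.

(** The atoms, enumerated by an initial segment of the natural numbers as in
    [cylinder]. *)
Lemma disjoint_refinement : exists m (V : 'I_m -> set T) (J : L -> 'I_m -> bool),
  [/\ trivIset setT V, (forall l, measurable (C l)) -> forall j, measurable (V j),
      forall j, V j = set0 \/ exists l, V j `<=` C l &
      forall l, C l = \big[setU/set0]_(j | J l j) V j].
Proof.
pose s (j : 'I_#|{ffun L -> bool}|) : {ffun L -> bool} := enum_val j.
exists #|{ffun L -> bool}|, (fun j => atom (s j)), (fun l j => s j l).
split=> [i j _ _ /trivIset_atom h|mC j|j|l].
- by apply: enum_val_inj; exact: h.
- exact: measurable_atom.
- have [/existsP[l sl]|s0] := boolP [exists l, s j l].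
    by right; exists l; exact: atom_sub.
  by left; rewrite -subset0 => x [sx _]; move: s0; rewrite sx.
- pose P := [pred j : 'I_#|{ffun L -> bool}| | s j l].
  rewrite (eq_bigl (mem P))// -bigcup_pred (bigcup_atom l).
  apply/seteqP; split=> [x [t /= tl xt]|x [j /= jl xj]]; last by exists (s j).
  by exists (enum_rank t); rewrite /= ?inE /= /s enum_rankK.
Qed.

End atoms.

(** * Kernels are determined by disjoint cylinder events *)

Section determination.
Context {R : realType} {X : polishType R}.
Variable S : point_process R X.
Variables a b : pmeasure X -> {measure set (borel X) -> \bar R}.
Hypothesis ma : forall A, bounded_borel A -> measurable_fun setT (a ^~ A).
Hypothesis mb : forall A, bounded_borel A -> measurable_fun setT (b ^~ A).
Hypothesis ab : forall n (C : 'I_n -> set (borel X)) k j,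
  (forall i, bounded_borel (C i)) -> trivIset setT C ->
  \int[S]_(mu in cylinder C k) a mu (C j) =
  \int[S]_(mu in cylinder C k) b mu (C j).

(** The sets [C i] and [A] are split into atoms [V j].  The event [cylinder C k] is
    the disjoint union, over the countably many vectors [c] of counts with the
    prescribed sums, of the events [cylinder V c], and [A] is a finite disjoint
    union of atoms; both sides of the identity are additive. *)
Let ab_cylinder n (C : 'I_n -> set (borel X)) k A :
  (forall i, bounded_borel (C i)) -> bounded_borel A ->
  \int[S]_(mu in cylinder C k) a mu A = \int[S]_(mu in cylinder C k) b mu A.
Proof.
move=> bC bA; pose CA (o : option 'I_n) := if o is Some i then C i else A.
have bCA o : bounded_borel (CA o) by case: o.
have [m [V [J [tV mV' V0 CAE]]]] := disjoint_refinement CA.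
have mV j : measurable (V j) by apply: mV' => l; case: (bCA l).
have bV j : bounded_borel (V j).
  case: (V0 j) => [->|[l Vl]]; first exact: bounded_borel0.
  exact: bounded_borelS (bCA l).
have sumV (nu : {measure set (borel X) -> \bar R}) l :
    nu (CA l) = \sum_(j | J l j) nu (V j).
  by rewrite CAE measure_bigsetU_ord.
pose K (c : {ffun 'I_m -> nat}) :=
  [forall i, (\sum_(j | J (Some i) j) c j)%N == k i].
pose F i := if pickle_inv i is Some c then
  if K c then cylinder V c else set0 else set0.
have countV (mu : pmeasure X) c i : cylinder V c mu ->
    mu (C i) = (\sum_(j | J (Some i) j) c j)%N%:R%:E.
  move=> muc; rewrite -[C i]/(CA (Some i)) sumV natr_sum -sumEFin.
  by apply: eq_bigr => j _; exact: muc.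
have inF mu i : F i mu ->
    exists c, [/\ pickle_inv i = Some c, K c & cylinder V c mu].
  by rewrite /F; case: pickle_inv => // c; case: ifPn => // Kc mucV; exists c.
have mF i : measurable (F i).
  rewrite /F; case: pickle_inv => // c; case: ifP => // _.
  exact: measurable_cylinder.
have tF : trivIset setT F.
  move=> i j _ _ [mu [/inF[c [ic _ muc]] /inF[c' [jc' _ muc']]]].
  have cc' : c = c'.
    apply/ffunP => l; apply/eqP; rewrite -(@eqr_nat R); apply/eqP.
    by apply: EFin_inj; rewrite -muc -muc'.
  have := @pickle_invK {ffun 'I_m -> nat} i.
  have := @pickle_invK {ffun 'I_m -> nat} j.
  by rewrite ic jc' cc' /= => -> ->.
have FE : cylinder C k = \bigcup_i F i.
  apply/seteqP; split=> [mu muk|mu [i _ /inF[c [_ /forallP Kc muc]]] l]; last first.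
    by rewrite (countV _ _ _ muc) (eqP (Kc l)).
  have [f fE] := choice (fun j => pm_nat mu (bV j)).
  pose c := [ffun j => f j].
  have muc : cylinder V c mu by move=> j; rewrite fE ffunE.
  exists (pickle c) => //; rewrite /F pickleK_inv ifT//.
  apply/forallP => l; rewrite -(@eqr_nat R); apply/eqP.
  by apply: EFin_inj; rewrite -(countV _ _ _ muc) muk.
have sumA (nu : pmeasure X -> {measure set (borel X) -> \bar R}) c :
    (forall A, bounded_borel A -> measurable_fun setT (nu ^~ A)) ->
    \int[S]_(mu in cylinder V c) nu mu A =
    \sum_(j | J None j) \int[S]_(mu in cylinder V c) nu mu (V j).
  move=> mnu; rewrite -big_filter -ge0_integral_sum//.
  - by apply: eq_integral => mu _; rewrite big_filter -(sumV (nu mu) None).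
  - exact: measurable_cylinder.
  - by move=> j; apply: measurable_funTS; exact: mnu.
rewrite FE !ge0_integral_bigcup//;
  try (by apply: measurable_funTS; first [exact: ma|exact: mb]).
apply: eq_eseriesr => i _; rewrite /F.
case: pickle_inv => [c|]; last by rewrite !integral_set0.
case: ifP => _; last by rewrite !integral_set0.
by rewrite !sumA//; apply: eq_bigr => j _; exact: ab.
Qed.

Let cylinders : set (set (pmeasure X)) :=
  [set E | exists n (C : 'I_n -> set (borel X)) k,
    (forall i, bounded_borel (C i)) /\ E = cylinder C k].

Let cylinders1 A k : bounded_borel A ->
  cylinders [set mu : pmeasure X | mu A = k%:R%:E].
Proof.
by move=> bA; exists 1%N, (fun=> A), (fun=> k); split=> //; rewrite cylinder1.
Qed.

Let setI_cylinders : setI_closed cylinders.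
Proof.
move=> _ _ [n [C [k [bC ->]]]] [m [C' [k' [bC' ->]]]].
exists (n + m)%N.
exists (fun i : 'I_(n + m) =>
  match fintype.split i with inl j => C j | inr j => C' j end).
exists (fun i : 'I_(n + m) =>
  match fintype.split i with inl j => k j | inr j => k' j end).
split; first by move=> i; case: fintype.split.
apply/seteqP; split=> [mu [muk muk'] i|mu mui]; first by case: fintype.split.
split=> j.
  by have := mui (lshift m j); rewrite (unsplitK (inl j)).
by have := mui (rshift n j); rewrite (unsplitK (inr j)).
Qed.

Let sigma_cylinders : measurable = <<s cylinders >>.
Proof.
apply/seteqP; split.
  apply: smallest_sub; first exact: smallest_sigma_algebra.
  move=> _ [A bA [Y mY <-]]; rewrite setTI.
  rewrite (_ : _ @^-1` Y = \bigcup_(n in [set n | Y n%:R%:E])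
      [set mu : pmeasure X | mu A = n%:R%:E]).
    apply: (@bigcup_measurable _ (g_sigma_algebraType cylinders)) => n _.
    by apply: sub_sigma_algebra; exact: cylinders1.
  apply/seteqP; split=> [mu /= YA|mu [n /= Yn ->]//].
  by have [n nE] := pm_nat mu bA; exists n => //=; rewrite -nE.
apply: smallest_sub; first exact: sigma_algebra_measurable.
by move=> _ [n [C [k [bC ->]]]]; exact: measurable_cylinder.
Qed.

Hypothesis b_fin : forall A k, bounded_borel A ->
  \int[S]_(mu in [set mu | mu A = k%:R%:E]) b mu A < +oo.

(** The events [mu A = k] cover the space of point measures because [mu A] is an
    integer; on each of them the integral is finite, whether or not the
    expectation of [b mu A] is. *)
Let ab_bounded A : bounded_borel A -> {ae S, forall mu, a mu A = b mu A}.
Proof.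
move=> bA.
pose g (k : nat) := [set mu : pmeasure X | mu A = k%:R%:E].
have abE E : cylinders E -> \int[S]_(mu in E) a mu A = \int[S]_(mu in E) b mu A.
  by move=> [n [C [k [bC ->]]]]; exact: ab_cylinder.
apply: (ae_eq_pi_system (G := cylinders) (g := g)) => //.
- by move=> k; exact: cylinders1.
- rewrite -subTset => mu _; have [n nE] := pm_nat mu bA; by exists n.
- exact: ma.
- exact: mb.
- by move=> k; rewrite abE ?b_fin//; exact: cylinders1.
Qed.

Hypothesis b_locally_finite : forall mu A, bounded_borel A -> b mu A < +oo.

Lemma ae_eq_of_disjoint_cylinders :
  {ae S, forall mu, forall A, measurable A -> a mu A = b mu A}.
Proof.
have [G [bG GI Gcover GE]] := @bounded_pi_system R X.
apply: filterS (ae_foralln (fun n => ab_bounded (bG n))) => mu abG A mA.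
apply: (measure_unique (range G) G) => //; first by move=> _ [n _ <-]; exact: abG.
by move=> k; rewrite abG; exact: b_locally_finite.
Qed.

End determination.

(** * The Bayes estimator of the Polya sum process *)

Theorem corollary2p3 (R : realType) (X : polishType R) (z : R)
    (rho : lfmeasure X)
    (P : lfmeasure X -> point_process R X)
    (D : random_measure R X) (S : point_process R X)
    (B : R.-pker (pmeasure X) ~> (lfmeasure X)) :
  (0 < z < 1)%R ->
  (forall kappa : lfmeasure X, poisson_process kappa (P kappa)) ->
  poisson_gamma z rho D ->
  polya_sum z rho S ->
  bayes_kernel P D S B ->
  {ae S, forall mu : pmeasure X, forall A : set (borel X), measurable A ->
    intensity (B mu) A = z%:E * (rho A + mu A)}.
Proof.
move=> /andP[/ltW z0 _] PP _ SP BP.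
pose b (mu : pmeasure X) : {measure set (borel X) -> \bar R} :=
  mscale (NngNum z0) (measure_add rho mu).
have bE mu A : b mu A = z%:E * (rho A + mu A).
  by rewrite -measure_addE.
have b_eval A : b ^~ A = fun mu => z%:E * (rho A + mu A).
  by apply/funext => mu; exact: bE.
have b_fin mu A : bounded_borel A -> b mu A < +oo.
  move=> bA; rewrite bE lte_mul_pinfty// ?lee_fin//.
  by rewrite lte_add_pinfty// lfm_fin.
suff : {ae S, forall mu, forall A, measurable A -> intensity (B mu) A = b mu A}.
  by apply: filterS => mu h A mA; rewrite h// bE.
apply: ae_eq_of_disjoint_cylinders => //.
- by move=> A [mA _]; exact: measurable_posterior_intensity.
- by move=> A bA; rewrite b_eval; exact: measurable_polya_kernel.
- move=> n C k j bC tC; under [RHS]eq_integral do rewrite bE.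
  by rewrite (integral_posterior_cylinder PP BP)// (integral_polya_cylinder SP).
- move=> A k bA.
  have mk : measurable [set mu : pmeasure X | mu A = k%:R%:E].
    by rewrite -cylinder1; exact: measurable_cylinder.
  rewrite (eq_integral (cst (z%:E * (rho A + k%:R%:E)))); last first.
    by move=> mu /set_mem/= muA; rewrite bE muA.
  have zA : 0 <= z%:E * (rho A + k%:R%:E) by rewrite mule_ge0// adde_ge0.
  rewrite integral_cst// lte_mul_pinfty//; last first.
    by rewrite (le_lt_trans (probability_le1 S mk))// ltry.
  rewrite ge0_fin_numE// lte_mul_pinfty// ?lee_fin//.
  by rewrite lte_add_pinfty ?ltry// lfm_fin.
Qed.
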